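(* Let $A$, $\alpha$, $T$, $C$, $\mathcal O$, $\omega$, $\mathcal K_\alpha$ and $H_\alpha=\chi_\omega^n\nabla\mathcal K_\alpha^*$ be as defined in the context. The following assertions are equivalent: 1. The system ${}^{C}\mathcal D_{0^+}^{\alpha}u=Au$ in $Q_T$, $u=0$ on $\Sigma_T$, $u(\cdot,0)=u_0$ in $\Omega$, augmented with the output $z(t)=Cu(t)$, is approximately $G$-observable in $\omega$. 2. $\operatorname{Ker}(H_\alpha^* )=\{0\}$. 3. $H_\alpha H_\alpha^*$ is positive definite. 4. For every $y\in (L^2(\omega))^n$: if $\langle (\chi_\omega^n)^*y,\nabla\mathcal K_\alpha^*z\rangle_{E^n}=0$ for all $z\in L^2(0,T;\mathcal O)$, then $y=0$ in $(L^2(\omega))^n$.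
   Context: Let $\Omega\subset\mathbb R^n$ ($n\ge1$) be open, bounded and connected with Lipschitz boundary, $T>0$, $\alpha\in(0,1]$, $Q_T=\Omega\times[0,T]$, $\Sigma_T=\partial\Omega\times[0,T]$, $E=L^2(\Omega)$. The operator $A$ on $E$ has domain $\mathcal D(A)=H^2(\Omega)\cap H^1_0(\Omega)$ and $Ay=\sum_{k,l=1}^n\partial_{x_k}(a_{k,l}\,\partial_{x_l}y)$, with $a_{k,l}\in C^1(\overline\Omega)$, $a_{k,l}=a_{l,k}$, and there is $\mu>0$ with $\sum_{k,l}a_{k,l}(x)\varsigma_k\varsigma_l\ge\mu\|\varsigma\|^2$ for all $x\in\Omega$, $\varsigma\in\mathbb R^n$. The eigenvalues of $-A$ are $0<\lambda_1<\lambda_2<\cdots\to+\infty$; $\lambda_i$ has finite multiplicity $r_i$ with eigenfunctions $\varphi_{i,j}\in\mathcal D(A)$, $-A\varphi_{i,j}=\lambda_i\varphi_{i,j}$, $1\le j\le r_i$, and $\{\varphi_{i,j}\}$ is an orthonormal basis of $E$. The Caputo derivative is ${}^{C}\mathcal D_{0^+}^{\alpha}u(\cdot,t)=\int_0^t\frac{(t-e)^{-\alpha}}{\Gamma(1-\alpha)}\partial_e u(\cdot,e)\,de$ (the ordinary derivative if $\alpha=1$). For $u_0\in H_0^1(\Omega)$ the mild solution of the system is $u(t)=\mathcal S_\alpha(t)u_0:=\sum_{i\ge1}E_\alpha(-\lambda_it^\alpha)\sum_{j=1}^{r_i}\langle u_0,\varphi_{i,j}\rangle\varphi_{i,j}$,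 where $E_\alpha(z)=\sum_{k\ge0}z^k/\Gamma(\alpha k+1)$. The observation operator $C:E\to\mathcal O$ (linear, possibly unbounded; $\mathcal O$ a Hilbert space) satisfies the admissibility condition: there is $M>0$ with $\int_0^T\|C\mathcal S_\alpha(t)v\|_{\mathcal O}^2dt\le M\|v\|_E^2$ for all $v\in\mathcal D(A)$. The observability operator is $\mathcal K_\alpha:\mathcal D(\mathcal K_\alpha)\subset E\to L^2(0,T;\mathcal O)$, $(\mathcal K_\alpha u_0)(t)=C\mathcal S_\alpha(t)u_0$, with adjoint $\mathcal K_\alpha^*z=\int_0^T\mathcal S_\alpha^*(e)C^*z(e)\,de$. $\omega\subset\Omega$ is a subregion; $\chi_\omega^n:E^n\to(L^2(\omega))^n$ is componentwise restriction to $\omega$, and its adjoint $(\chi_\omega^n)^*$ is componentwise extension by $0$ to $\Omega$. $\nabla:\mathcal D(\nabla)=H_0^1(\Omega)\subset E\to E^n$ is the gradient. Set $H_\alpha=\chi_\omega^n\nabla\mathcal K_\alpha^*$, an operator from (a subspace of) $L^2(0,T;\mathcal O)$ to $(L^2(\omega))^n$. The system with output is called approximately $G$-observable in $\omega$ if $\overline{\operatorname{Im}(H_\alpha)}=(L^2(\omega))^n$. *)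

(* Defs.v *)
From HB Require Import structures.
From mathcomp Require Import all_boot all_order all_algebra.
From mathcomp Require Import all_classical all_reals all_analysis.
From mathcomp Require Import measurable_realfun sesquilinear.

Set Implicit Arguments.
Unset Strict Implicit.
Unset Printing Implicit Defensive.
Import Order.TTheory GRing.Theory Num.Theory.
Import numFieldNormedType.Exports.
Local Open Scope classical_set_scope.
Local Open Scope ring_scope.

(* Borel sigma-algebra. *)
HB.instance Definition _ (R : realType) (m n : nat) :=
  @isMeasurable.Build (sigma_display (@open 'M[R]_(m, n))) 'M[R]_(m, n)
    <<s @open 'M[R]_(m, n) >> (@sigma_algebra0 _ setT _)
    (@sigma_algebraC _ _) (@sigma_algebra_bigcup _ setT _).

Section lebesgue_rV.
Variable R : realType.
Implicit Types n : nat.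

Lemma open_measurable_rV n (U : set 'rV[R]_n) : open U -> measurable U.
Proof. exact: sub_sigma_algebra. Qed.

Definition cons_rV n (p : measurableTypeR R * 'rV[R]_n) : 'rV[R]_n.+1 :=
  \row_i (if unlift ord0 i is Some j then p.2 ord0 j else p.1).

Definition uncons_rV n (v : 'rV[R]_n.+1) : measurableTypeR R * 'rV[R]_n :=
  (v ord0 ord0, \row_j v ord0 (lift ord0 j)).

Lemma cons_rVK n : cancel (@cons_rV n) (@uncons_rV n).
Proof.
move=> [x v]; rewrite /uncons_rV !mxE unlift_none; congr pair.
by apply/rowP => j; rewrite !mxE liftK.
Qed.

Lemma measurable_cons_rV n : measurable_fun setT (@cons_rV n).
Proof.
apply: (@measurability _ _ _ _ _ _ (@open 'rV[R]_n.+1)) => // _ [U oU <-].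
rewrite setTI.
pose box (k : rat * 'rV[rat]_n * nat) : set (measurableTypeR R * 'rV[R]_n) :=
  ball (ratr k.1.1 : R) k.2.+1%:R^-1 `*` ball (map_mx ratr k.1.2 : 'rV[R]_n) k.2.+1%:R^-1.
have -> : @cons_rV n @^-1` U =
    \bigcup_(k in [set k | box k `<=` @cons_rV n @^-1` U]) box k.
  rewrite eqEsubset; split => [[x v] /= Uxv|]; last by move=> p [k bU kp]; exact: bU.
  have /nbhs_ballP[e /= e0 eU] := open_nbhs_nbhs (conj oU Uxv).
  have [m me] : exists m, m.+1%:R^-1 < e / 2.
    have [m _ H] := near_infty_natSinv_lt (PosNum (divr_gt0 e0 (ltr0n _ 2))).
    by exists m; apply: (H m) => /=.
  have d0 : 0 < m.+1%:R^-1 :> R by rewrite invr_gt0.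
  have rat_near (y : R) : exists q : rat, `|ratr q - y| < m.+1%:R^-1.
    have yy : y - m.+1%:R^-1 < y + m.+1%:R^-1 by rewrite ltrD2l (lt_trans _ d0)// oppr_lt0.
    have [q] := rat_in_itvoo yy; rewrite in_itv/= => /andP[q1 q2]; exists q.
    by rewrite distrC ltr_distlC; apply/andP; split; [exact: q1|exact: q2].
  have [q qx] := rat_near x.
  have /choice[w wv] : forall j, exists q : rat, `|ratr q - v ord0 j| < m.+1%:R^-1.
    by move=> j; exact: rat_near.
  exists (q, \row_j w j, m) => /=.
    move=> [y u] [/= qy]; rewrite /ball /= => -[_ wu].
    apply: eU; rewrite /ball/=; split => // i j.
    rewrite (ord1 i) !mxE; case: unliftP => [j' _|_].
      have := wu ord0 j'; rewrite !mxE => wu'.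
      apply: (@ball_splitr _ _ (ratr (w j') : R)); apply: (le_ball (ltW me)) => //.
      exact: wv.
    by apply: (@ball_splitr _ _ (ratr q : R)); exact: (le_ball (ltW me)).
  split => //=; rewrite /ball/=; split => // i j.
  by rewrite (ord1 i) !mxE; exact: wv.
rewrite bigcup_mkcond; apply: countable_bigcupT_measurable => // k.
case: ifPn => // _; apply: measurableX; first by apply: open_measurable; exact: ball_open.
by apply: open_measurable_rV; exact: ball_open.
Qed.

Lemma continuous_measurable_rV n (f : 'rV[R]_n -> R) :
  continuous f -> measurable_fun setT f.
Proof.
move=> /continuousP cf; apply: (measurability _ (RGenOpens.measurableE R)).
move=> _ [_ [a [b ->] <-]]; rewrite setTI; apply: open_measurable_rV.
exact/cf/interval_open.
Qed.

Lemma continuous_measurable_rV_rV n k (f : 'rV[R]_n -> 'rV[R]_k) :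
  continuous f -> measurable_fun setT f.
Proof.
move=> /continuousP cf; apply: (@measurability _ _ _ _ _ _ (@open 'rV[R]_k)) => //.
by move=> _ [U oU <-]; rewrite setTI; apply: open_measurable_rV; exact: cf.
Qed.

Lemma measurable_uncons_rV n : measurable_fun setT (@uncons_rV n).
Proof.
apply/measurable_fun_pair => /=.
  by apply: continuous_measurable_rV; exact: coord_continuous.
apply: continuous_measurable_rV_rV => v A /nbhs_ballP[e /= e0 eA].
apply/nbhs_ballP; exists e => // u [_ vu]; apply: eA; split => // i j.
by rewrite !mxE; exact: vu.
Qed.

Section lebesgue_rV_step.
Variables (n : nat) (mu : {sigma_finite_measure set 'rV[R]_n -> \bar R}).

Definition lebesgue_rVS_fun :=
  pushforward (@lebesgue_measure R \x mu)%E (@cons_rV n).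


Let rVS0 : lebesgue_rVS_fun set0 = 0%E.
Proof. by rewrite /lebesgue_rVS_fun /pushforward preimage_set0 measure0. Qed.

Let mpre (A : set 'rV[R]_n.+1) : measurable A -> measurable (@cons_rV n @^-1` A).
Proof. by move=> mA; rewrite -[X in measurable X]setTI; exact: measurable_cons_rV. Qed.

Let rVS_ge0 A : (0 <= lebesgue_rVS_fun A)%E.
Proof. by rewrite /lebesgue_rVS_fun /pushforward; exact: measure_ge0. Qed.

Let rVS_sigma_additive : semi_sigma_additive lebesgue_rVS_fun.
Proof.
move=> F mF tF mUF; rewrite /lebesgue_rVS_fun /pushforward preimage_bigcup.
apply: measure_semi_sigma_additive; first by move=> i; exact: mpre.
  apply/trivIsetP => i j _ _ ij; rewrite -preimage_setI.
  by move/trivIsetP : tF => ->//; rewrite preimage_set0.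
by rewrite -preimage_bigcup; exact: mpre.
Qed.

HB.instance Definition _ := isMeasure.Build _ _ _ lebesgue_rVS_fun
  rVS0 rVS_ge0 rVS_sigma_additive.

Let rVS_sigma_finite : sigma_finite setT lebesgue_rVS_fun.
Proof.
have /sigma_finiteP[F [TF ndF Foo]] := sigma_finiteT (@lebesgue_measure R).
have /sigma_finiteP[G [TG ndG Goo]] := sigma_finiteT mu.
exists (fun i => @uncons_rV n @^-1` (F i `*` G i)).
  rewrite -preimage_bigcup (_ : \bigcup_i (F i `*` G i) = setT) ?preimage_setT//.
  rewrite -setXTT TF TG predeqE => -[x y]; split.
    by move=> [k _ []/= ? ?]; split; exists k.
  move=> [/= [k _ Fkx] [l _ Gly]]; exists (maxn k l) => //; split.
  - by move: x Fkx; exact/subsetPset/ndF/leq_maxl.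
  - by move: y Gly; exact/subsetPset/ndG/leq_maxr.
move=> i; have [mF Fi] := Foo i; have [mG Gi] := Goo i; split.
  rewrite -[X in measurable X]setTI; apply: measurable_uncons_rV => //.
  exact: measurableX.
rewrite /lebesgue_rVS_fun /pushforward -comp_preimage.
rewrite (_ : _ \o _ = id); last by apply/funext; exact: cons_rVK.
by rewrite preimage_id product_measure1E// lte_mul_pinfty// ge0_fin_numE.
Qed.

HB.instance Definition _ := Measure_isSigmaFinite.Build _ _ _ lebesgue_rVS_fun
  rVS_sigma_finite.

Definition lebesgue_rVS : {sigma_finite_measure set 'rV[R]_n.+1 -> \bar R} :=
  lebesgue_rVS_fun.

End lebesgue_rV_step.

(* Lebesgue measure on R^n, as the n-fold product of the one on R. *)
Fixpoint lebesgue_rV n : {sigma_finite_measure set 'rV[R]_n -> \bar R} :=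
  if n is m.+1 then lebesgue_rVS (lebesgue_rV m) else dirac (0 : 'rV[R]_0).

Lemma lebesgue_rV_prod n (A : 'I_n -> set R) : (forall i, measurable (A i)) ->
  lebesgue_rV n [set v | forall i, A i (v ord0 i)] =
  (\prod_(i < n) (@lebesgue_measure R (A i)))%E.
Proof.
elim: n A => [A _|n IHn A mA] /=.
  by rewrite big_ord0 diracE mem_set// => -[].
rewrite /lebesgue_rVS/= /lebesgue_rVS_fun /pushforward.
pose B := [set v : 'rV[R]_n | forall i : 'I_n, A (lift ord0 i) (v ord0 i)].
have mB : measurable B.
  rewrite (_ : B = \bigcap_(i in [set` 'I_n])
      ((fun v : 'rV[R]_n => v ord0 i) @^-1` A (lift ord0 i))); last first.
    by rewrite eqEsubset; split => v /= H i; [move=> _; exact: H|exact: H].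
  apply: fin_bigcap_measurable => // i _.
  rewrite -[X in measurable X]setTI.
  by apply: continuous_measurable_rV => //; exact: coord_continuous.
rewrite [X in product_measure1 _ _ X](_ : _ =
    (A ord0 : set (measurableTypeR R)) `*` B).
  rewrite product_measure1E//; last exact: mA.
  rewrite big_ord_recl; congr mule.
  by apply: (IHn (fun i => A (lift ord0 i))) => i; exact: mA.
rewrite eqEsubset; split => -[x v] /=.
  move=> H; split; first by have := H ord0; rewrite mxE unlift_none.
  by move=> i; have := H (lift ord0 i); rewrite mxE liftK.
by move=> [Ax Av] i; rewrite mxE; case: unliftP => [j ->|->].
Qed.

End lebesgue_rV.

Section L2.
Context d (T : measurableType d) (R : realType).
Variable mu : {measure set T -> \bar R}.

(* Elements of L^2(mu) are square-integrable functions, and two of them denote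
   the same element when they are equal mu-almost everywhere. *)
Definition L2 : set (T -> R) := [set f | f \in Lfun mu 2%:E].

Definition L2_inner (f g : T -> R) : R := \int[mu]_x (f x * g x).

Definition L2_cvg (f_ : nat -> T -> R) (f : T -> R) : Prop :=
  Lnorm mu 2%:E (EFin \o (f_ m \- f)) @[m --> \oo] --> 0%E.

Definition L2n n : set ('I_n -> T -> R) := [set y | forall k, L2 (y k)].

Definition L2n_inner n (y w : 'I_n -> T -> R) : R :=
  \sum_k L2_inner (y k) (w k).

Definition L2n_norm n (y : 'I_n -> T -> R) : R := Num.sqrt (L2n_inner y y).

Definition L2n_eq n (y w : 'I_n -> T -> R) : Prop :=
  forall k, y k = w k %[ae mu].

Definition L2n_closure n (S : set ('I_n -> T -> R)) : set ('I_n -> T -> R) :=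
  [set y | L2n y /\ forall e, 0 < e ->
     exists2 h, S h & L2n_norm (fun k => y k \- h k) < e].

End L2.

Section bochner.
Context d (T : measurableType d) (R : realType).
Variables (mu : {measure set T -> \bar R}).
Variables (V : completeNormedModType R) (ip : V -> V -> R).

Definition vsimple (s : T -> V) : Prop :=
  exists m (A : 'I_m -> set T) (v : 'I_m -> V),
    (forall j, measurable (A j)) /\
    s = (fun t => \sum_j (\1_(A j) t : R) *: v j).

Definition strongly_measurable (z : T -> V) : Prop :=
  exists s_ : nat -> T -> V,
    (forall m, vsimple (s_ m)) /\
    forall t, s_ m t @[m --> \oo] --> z t.

Definition bochner_L2 : set (T -> V) :=
  [set z | strongly_measurable z /\
           (\int[mu]_t ((`|z t| ^+ 2)%:E) < +oo)%E].

Definition bochner_inner (z w : T -> V) : R := \int[mu]_t ip (z t) (w t).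

End bochner.

(* Operators that need not be bounded nor everywhere defined are given by their
   graphs.  The adjoint of G : X -> Y is the graph
     { (y, x) | <y', y> = <x', x> for all (x', y') in G },
   that is the graph of the usual adjoint as soon as G has a dense domain. *)
Section operators.
Variables (R : realType) (X Y : Type).
Variables (X_elt : set X) (X_inner : X -> X -> R).
Variables (Y_elt : set Y) (Y_inner : Y -> Y -> R).

Definition adjoint (G : X -> Y -> Prop) (y : Y) (x : X) : Prop :=
  [/\ Y_elt y, X_elt x &
      forall x' y', G x' y' -> Y_inner y' y = X_inner x' x].

Definition image_of (G : X -> Y -> Prop) : set Y := [set y | exists x, G x y].

Definition comp_graph Z (G : X -> Y -> Prop) (F : Z -> X -> Prop)
    (z : Z) (y : Y) : Prop :=
  exists2 x, F z x & G x y.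

End operators.

Section domain.
Variables (R : realType) (n : nat).
Local Notation Rn := 'rV[R]_n.

Definition dotp (x y : Rn) : R := \sum_i x ord0 i * y ord0 i.

Definition enorm (x : Rn) : R := Num.sqrt (dotp x x).

(* Near each boundary point, Omega is the strict epigraph, in some unit
   direction nu, of a Lipschitz function of the component orthogonal to nu. *)
Definition lipschitz_boundary (Omega : set Rn) : Prop :=
  forall x0, (closure Omega `\` interior Omega) x0 ->
    exists (nu : Rn) (r L : R) (gamma : Rn -> R),
      [/\ dotp nu nu = 1, 0 < r,
          forall x y, `|gamma x - gamma y| <= L * enorm (x - y) &
          forall x, enorm (x - x0) < r ->
            Omega x <-> gamma (x - dotp x nu *: nu) < dotp x nu].

Definition basis_vec (k : 'I_n) : Rn := delta_mx ord0 k.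

Definition partial (k : 'I_n) (f : Rn -> R) : Rn -> R := 'D_(basis_vec k) f.

Fixpoint Cm (m : nat) (f : Rn -> R) : Prop :=
  continuous f /\
  if m is m'.+1 then
    forall k, (forall x, derivable f x (basis_vec k)) /\ Cm m' (partial k f)
  else True.

Definition test_function (Omega : set Rn) (f : Rn -> R) : Prop :=
  [/\ forall m, Cm m f,
      compact (closure [set x | f x != 0]) &
      closure [set x | f x != 0] `<=` Omega].

Definition C1_closure (Omega : set Rn) (f : Rn -> R) : Prop :=
  {within closure Omega, continuous f} /\
  forall k, exists2 g : Rn -> R, {within closure Omega, continuous g} &
    forall x, Omega x -> derivable f x (basis_vec k) /\ partial k f x = g x.

Definition lebesgue_on (D : set Rn) (mD : measurable D) :
    {measure set Rn -> \bar R} :=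
  mrestr (lebesgue_rV R n) mD.

End domain.

Section sobolev.
Variables (R : realType) (n : nat).
Local Notation Rn := 'rV[R]_n.
Variables (Omega : set Rn) (oOmega : open Omega).

Definition mu_open : {measure set Rn -> \bar R} :=
  lebesgue_on (open_measurable_rV oOmega).
Local Notation mu := mu_open.

Definition weak_partial (k : 'I_n) (u g : Rn -> R) : Prop :=
  forall f, test_function Omega f ->
    \int[mu]_x (u x * partial k f x) = - \int[mu]_x (g x * f x).

Definition weak_gradient (u : Rn -> R) (g : 'I_n -> Rn -> R) : Prop :=
  [/\ L2 mu u, L2n mu g & forall k, weak_partial k u (g k)].

(* H^1_0 is the closure of the test functions in the H^1 norm. *)
Definition H10 : set (Rn -> R) :=
  [set u | exists2 g, weak_gradient u g &
     exists f_ : nat -> Rn -> R,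
       [/\ forall m, test_function Omega (f_ m),
           L2_cvg mu f_ u &
           forall k, L2_cvg mu (fun m => partial k (f_ m)) (g k)]].

Definition H2 : set (Rn -> R) :=
  [set u | exists2 g, weak_gradient u g &
     forall k, exists h, weak_gradient (g k) h].

Definition grad (u : Rn -> R) (g : 'I_n -> Rn -> R) : Prop :=
  H10 u /\ weak_gradient u g.

(* Graph of  A u = sum_(k,l) d_k (a_kl d_l u)  on  H^2 /\ H^1_0. *)
Definition elliptic_op (a : 'I_n -> 'I_n -> Rn -> R) (u f : Rn -> R) : Prop :=
  [/\ H2 u, H10 u, L2 mu f &
    exists g, weak_gradient u g /\
    exists p : 'I_n -> 'I_n -> Rn -> R,
      (forall k l, L2 mu (p k l) /\
                   weak_partial k (a k l \* g l) (p k l)) /\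
      f = (fun x => \sum_k \sum_l p k l x) %[ae mu]].

Definition elliptic_dom (a : 'I_n -> 'I_n -> Rn -> R) : set (Rn -> R) :=
  [set u | exists f, elliptic_op a u f].

Definition eigenfunction a (l : R) (u : Rn -> R) : Prop :=
  elliptic_op a u (fun x => - (l * u x)).

(* The distinct eigenvalues of -A in increasing order, with multiplicities
   r i, and an orthonormal basis of L^2(Omega) of eigenfunctions phi i j,
   j < r i. *)
Record spectral_basis (a : 'I_n -> 'I_n -> Rn -> R)
    (lambda : nat -> R) (r : nat -> nat) (phi : nat -> nat -> Rn -> R) :
    Prop := {
  spectral_gt0 : 0 < lambda 0%N ;
  spectral_incr : forall i, lambda i < lambda i.+1 ;
  spectral_pinfty : lambda i @[i --> \oo] --> +oo ;
  spectral_eigenvalues : forall l,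
    (exists i, l = lambda i) <->
    (exists2 u, eigenfunction a l u & ~ (u = cst 0 %[ae mu])) ;
  spectral_eigenfunctions : forall i j, (j < r i)%N ->
    eigenfunction a (lambda i) (phi i j) ;
  spectral_multiplicity : forall i u, eigenfunction a (lambda i) u ->
    u = (fun x => \sum_(j < r i) L2_inner mu u (phi i j) * phi i j x)
      %[ae mu] ;
  spectral_orthonormal : forall i j i' j', (j < r i)%N -> (j' < r i')%N ->
    L2_inner mu (phi i j) (phi i' j') = ((i == i') && (j == j'))%:R ;
  spectral_total : forall u, L2 mu u ->
    L2_cvg mu
      (fun N x => \sum_(i < N) \sum_(j < r i)
                    L2_inner mu u (phi i j) * phi i j x) u }.

End sobolev.

Section mittag_leffler.
Variable R : realType.

Definition Gamma (s : R) : R :=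
  \int[@lebesgue_measure R]_(t in `]0, +oo[) (t `^ (s - 1) * expR (- t)).

Definition mittag_leffler (alpha z : R) : R :=
  limn (series (fun k => z ^+ k / Gamma (alpha * k%:R + 1))).

End mittag_leffler.

(* A possibly unbounded linear map from a subspace of L^2(mu) to V; it depends
   only on the almost-everywhere class of its argument. *)
Record observation_operator d (T : measurableType d) (R : realType)
    (mu : {measure set T -> \bar R}) (V : completeNormedModType R) := {
  obs_dom : set (T -> R) ;
  obs_fun : (T -> R) -> V ;
  obs_dom_L2 : obs_dom `<=` L2 mu ;
  obs_ae : forall u w, obs_dom u -> L2 mu w -> u = w %[ae mu] ->
    obs_dom w /\ obs_fun u = obs_fun w ;
  obs_dom0 : obs_dom (cst 0) ;
  obs_linear : forall c u w, obs_dom u -> obs_dom w ->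
    obs_dom (fun x => c * u x + w x) /\
    obs_fun (fun x => c * u x + w x) = c *: obs_fun u + obs_fun w }.

Section observability.
Variables (R : realType) (n : nat).
Local Notation Rn := 'rV[R]_n.
Variables (Omega : set Rn) (oOmega : open Omega).
Local Notation mu := (mu_open oOmega).
Variables (lambda : nat -> R) (r : nat -> nat) (phi : nat -> nat -> Rn -> R).
Variables (alpha T : R).
Variables (O : completeNormedModType R) (ip : O -> O -> R).
Variable C : observation_operator mu O.
Variables (omega : set Rn) (momega : measurable omega).

(* mild_solution u0 t w : the class of w is S_alpha(t) u0. *)
Definition mild_solution (u0 : Rn -> R) (t : R) (w : Rn -> R) : Prop :=
  L2 mu w /\
  L2_cvg mu
    (fun N x => \sum_(i < N) mittag_leffler alpha (- (lambda i * t `^ alpha)) *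
                  \sum_(j < r i) L2_inner mu u0 (phi i j) * phi i j x) w.

Definition time_measure : {measure set (measurableTypeR R) -> \bar R} :=
  mrestr (@lebesgue_measure R) (measurable_itv `[0, T]).

Definition L2O : set (R -> O) := bochner_L2 time_measure (V := O).

Definition L2O_inner : (R -> O) -> (R -> O) -> R :=
  bochner_inner time_measure ip.

(* K_alpha, on its natural domain: the u0 for which S_alpha(t) u0 lies in the
   domain of C for almost every t and t |-> C S_alpha(t) u0 is in L^2. *)
Definition K_op (u0 : Rn -> R) (z : R -> O) : Prop :=
  [/\ L2 mu u0, L2O z &
      \forall t \ae time_measure,
        exists w, [/\ mild_solution u0 t w, obs_dom C w & z t = obs_fun C w]].

Definition admissible (a : 'I_n -> 'I_n -> Rn -> R) : Prop :=
  exists2 M : R, 0 < M & forall v, elliptic_dom oOmega a v ->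
    exists2 z, K_op v z &
      (\int[time_measure]_t ((`|z t| ^+ 2)%:E) <=
       (M * L2_inner mu v v)%:E)%E.

Definition K_adj : (R -> O) -> (Rn -> R) -> Prop :=
  adjoint (L2 mu) (L2_inner mu) L2O L2O_inner K_op.

Definition mu_sub : {measure set Rn -> \bar R} := lebesgue_on momega.

(* Elements of L^2(omega) are represented by functions on the whole space taken
   modulo almost-everywhere equality on omega, so that restriction to omega and
   its adjoint, extension by 0 outside omega, act alike on representatives. *)
Definition chi (g : 'I_n -> Rn -> R) : 'I_n -> Rn -> R :=
  fun k => patch (cst 0) omega (g k).

Definition chi_adj (y : 'I_n -> Rn -> R) : 'I_n -> Rn -> R :=
  fun k => patch (cst 0) omega (y k).

Definition H_op (z : R -> O) (h : 'I_n -> Rn -> R) : Prop :=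
  L2n mu_sub h /\
  exists v g, [/\ K_adj z v, grad oOmega v g & L2n_eq mu_sub h (chi g)].

Definition H_adj : ('I_n -> Rn -> R) -> (R -> O) -> Prop :=
  adjoint L2O L2O_inner (@L2n _ _ _ mu_sub n) (@L2n_inner _ _ _ mu_sub n) H_op.

Definition approx_G_observable : Prop :=
  L2n_closure mu_sub (image_of H_op) = @L2n _ _ _ mu_sub n.

Definition L2n_zero : set ('I_n -> Rn -> R) :=
  [set y | L2n mu_sub y /\ L2n_eq mu_sub y (fun=> cst 0)].

Definition H_adj_kernel : set ('I_n -> Rn -> R) :=
  [set y | H_adj y (cst 0)].

Definition HHadj_positive_definite : Prop :=
  forall y h, comp_graph H_op H_adj y h -> ~ L2n_zero y ->
    0 < L2n_inner mu_sub h y.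

End observability.

(* Main.v *)
Require Import Defs.
From HB Require Import structures.
From mathcomp Require Import all_boot all_order all_algebra.
From mathcomp Require Import all_classical all_reals all_analysis.
From mathcomp Require Import measurable_realfun sesquilinear.
From mathcomp Require Import ring lra.
Set Implicit Arguments.
Unset Strict Implicit.
Unset Printing Implicit Defensive.
Import Order.TTheory GRing.Theory Num.Theory.
Import numFieldNormedType.Exports.
Local Open Scope classical_set_scope.
Local Open Scope ring_scope.

(** Everything reduces to one fact: Ker H* is the orthogonal complement of Im H
in L^2(omega)^n (lemma [H_adj_0P]).  It holds for any relation H, since
(y, 0) belongs to the graph of the adjoint exactly when <h, y> = <z, 0> = 0 for
all (z, h) in H.

- If Im H is dense, a vector orthogonal to it is orthogonal to itself, so
  Ker H* = 0.
- If H H* y = h through z = H* y, then <h, y> = <z, z>.  This is nonnegative,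
  and it vanishes only if z is 0 in L^2(0,T;O), that is if y is in Ker H*.
- H may be unbounded, so positivity of H H* is only known on its domain.  But a
  vector y orthogonal to Im H has H* y = 0, which is in the domain of H, and
  H H* y = H 0 = 0: such a y is always in the domain of H H*, and positivity
  forces y = 0.
- Moving the restriction to omega from one side of the inner product to the
  other ([chi_adj_inner]) identifies the last assertion with
  (Im H)^perp = 0.  Density of Im H then follows from the projection theorem
  ([L2n_closure_trivial_orthogonal]).

The last step is the only one with analytic content.  It needs L^2 to be
complete, for which a Riesz-Fischer theorem is proved, and Im H to be a linear
subspace ([H_op_lin]).  Linearity of H comes from linearity of its two factors:
an adjoint relation is linear because the two inner products are, and the weak
gradient on H^1_0 is linear because test functions form a vector space and
belong, together with their derivatives, to L^2(Omega), Omega being bounded. *)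

(** * Square-integrable functions *)

Section L2_theory.
Context d (T : measurableType d) (R : realType).
Variable mu : {measure set T -> \bar R}.
Implicit Types f g h : T -> R.

Lemma L2_measurable f : L2 mu f -> measurable_fun setT f.
Proof. by rewrite /L2/= inE => /andP[/[!inE]]. Qed.

Lemma L2_mul_integrable f g : L2 mu f -> L2 mu g ->
  mu.-integrable setT (EFin \o (fun x => f x * g x)).
Proof. by move=> Lf Lg; apply/Lfun1_integrable; exact: Lfun2_mul_Lfun1. Qed.

Lemma L2P f : L2 mu f <->
  measurable_fun setT f /\ (\int[mu]_x (f x ^+ 2)%:E < +oo)%E.
Proof.
split=> [Lf|[mf fy]].
  split; first exact: L2_measurable.
  have /integrableP[_] := L2_mul_integrable Lf Lf.
  by under eq_integral do rewrite /= -expr2 ger0_norm ?sqr_ge0//.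
rewrite /L2/= inE; apply/andP; split; rewrite inE//=.
rewrite /finite_norm unlock poweR_lty//=.
by under eq_integral do rewrite powR_mulrn// real_normK ?num_real//.
Qed.

Lemma L2_0 : L2 mu 0.
Proof. exact: (Lfun_submod_closed mu (lee1n 2)).1. Qed.

Lemma L2_lin c f g : L2 mu f -> L2 mu g -> L2 mu (c *: f + g).
Proof. exact: (Lfun_submod_closed mu (lee1n 2)).2. Qed.

Lemma L2B f g : L2 mu f -> L2 mu g -> L2 mu (f - g).
Proof. by move=> Lf Lg; rewrite addrC -scaleN1r; exact: L2_lin. Qed.

Lemma L2_innerC f g : L2_inner mu f g = L2_inner mu g f.
Proof. by apply: eq_Rintegral => x _; rewrite mulrC. Qed.

Lemma L2_inner_lin c f g h : L2 mu f -> L2 mu g -> L2 mu h ->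
  L2_inner mu (c *: f + g) h = c * L2_inner mu f h + L2_inner mu g h.
Proof.
move=> Lf Lg Lh; have Ifh := L2_mul_integrable Lf Lh.
rewrite /L2_inner -RintegralZl// -RintegralD//.
- by apply: eq_Rintegral => x _; rewrite mulrDl -mulrA.
- have /(integrableZl measurableT c) := Ifh.
  by apply: eq_integrable => // x _.
- exact: L2_mul_integrable.
Qed.

Lemma L2_inner_ae f f' g : L2 mu f -> L2 mu f' -> L2 mu g ->
  f = f' %[ae mu] -> L2_inner mu f g = L2_inner mu f' g.
Proof.
move=> Lf Lf' Lg ff'; congr fine; apply: ae_eq_integral => //.
- by have /measurable_int := L2_mul_integrable Lf Lg.
- by have /measurable_int := L2_mul_integrable Lf' Lg.
- by apply: filterS ff' => x /= /[apply] ->.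
Qed.

Lemma L2_inner_ge0 f : 0 <= L2_inner mu f f.
Proof. by apply: Rintegral_ge0 => x _; rewrite -expr2 sqr_ge0. Qed.

Lemma L2_innerE f : L2 mu f ->
  (L2_inner mu f f)%:E = (\int[mu]_x (f x ^+ 2)%:E)%E.
Proof.
move=> Lf; rewrite /L2_inner /Rintegral fineK; last first.
  exact: (integrable_fin_num measurableT (L2_mul_integrable Lf Lf)).
by apply: eq_integral => x _; rewrite expr2.
Qed.

Lemma L2_inner_eq0 f : L2 mu f -> L2_inner mu f f = 0 -> f = cst 0 %[ae mu].
Proof.
move=> Lf f0; have := L2_innerE Lf; rewrite f0 => /esym f0'.
have : (\int[mu]_x `|(f x ^+ 2)%:E| = 0)%E.
  rewrite -[RHS]f0'; apply: eq_integral => x _.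
  by rewrite gee0_abs// lee_fin sqr_ge0.
move/ae_eq_integral_abs => /= /(_ measurableT) H.
have {}H := H _; apply: filterS (H _) => [x /= /(_ I)/eqP|].
  by rewrite eqe sqrf_eq0 => /eqP.
apply/measurable_EFinP; apply: measurable_funX; exact: L2_measurable.
Qed.

Lemma L2_ae_inner0 f g : L2 mu f -> L2 mu g -> f = cst 0 %[ae mu] ->
  L2_inner mu g f = 0.
Proof.
move=> Lf Lg f0; rewrite L2_innerC (L2_inner_ae Lf L2_0 Lg f0).
rewrite /L2_inner; under eq_Rintegral do rewrite mul0r.
by rewrite Rintegral_cst// mul0r.
Qed.

Lemma L2_cvg_lin c (f_ g_ : nat -> T -> R) f g :
  (forall m, L2 mu (f_ m)) -> L2 mu f -> (forall m, L2 mu (g_ m)) -> L2 mu g ->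
  L2_cvg mu f_ f -> L2_cvg mu g_ g ->
  L2_cvg mu (fun m => c *: f_ m + g_ m) (c *: f + g).
Proof.
move=> Lf_ Lf Lg_ Lg ff gg.
pose N (u : T -> R) := Lnorm mu 2%:E (EFin \o u).
have N_lin u v : L2 mu u -> L2 mu v ->
    (N (c *: u + v)%R <= `|c|%:E * N u + N v)%E.
  move=> Lu Lv; rewrite /N -(LnormZ (Lfun_Sub (lee1n 2) Lu)).
  apply: eminkowski; last exact: (lee1n 2).
    by have := L2_lin c Lu L2_0; rewrite addr0; exact: L2_measurable.
  exact: L2_measurable Lv.
apply: (@squeeze_cvge _ _ _ _ (cst 0%E) _
    (fun m => `|c|%:E * N (f_ m - f)%R + N (g_ m - g)%R)%E).
- apply: nearW => m; rewrite Lnorm_ge0/=.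
  apply: le_trans (N_lin _ _ (L2B (Lf_ m) Lf) (L2B (Lg_ m) Lg)).
  rewrite le_eqVlt; apply/orP; left; apply/eqP; apply: eq_Lnorm => x /=.
  by congr EFin; rewrite !fctE scalerBr; ring.
- exact: cvg_cst.
- rewrite -[X in _ --> X]adde0 -[X in _ --> (X + _)%E](mule0 `|c|%:E).
  by apply: cvgeD => //; apply: cvgeZl.
Qed.

Lemma L2_cvg_cst f : L2_cvg mu (fun=> f) f.
Proof.
rewrite /L2_cvg (_ : (fun _ => _) = cst 0%E); first exact: cvg_cst.
apply/funext => m; rewrite -[RHS](@Lnorm0 _ _ _ mu 2%:E)//.
by apply: eq_Lnorm => x /=; rewrite subrr.
Qed.

End L2_theory.

(** * Completeness of L^2 *)

Section L2_complete.
Context d (T : measurableType d) (R : realType).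
Variable mu : {measure set T -> \bar R}.

Lemma limn_einf_le (u : (\bar R)^nat) (b : \bar R) :
  (forall k, u k <= b)%E -> (limn_einf u <= b)%E.
Proof.
move=> ub; rewrite limn_einf_lim; apply: lime_le; first exact: is_cvg_einfs.
apply: nearW => k; apply: le_trans (ub k).
by apply: ereal_inf_lbound; exists k => /=.
Qed.

Lemma cvgn_geometric_increments (u : nat -> R) (B : R) :
  (forall m, `|u m.+1 - u m| <= B / 2 ^+ m) -> cvgn u.
Proof.
move=> uB; rewrite (_ : u = cst (u 0) + series (telescope u)); last first.
  by apply/funext => m; exact: eq_sum_telescope.
have : cvgn (series (telescope u)).
  apply: normed_cvg; apply: (@series_le_cvg _ _ (geometric B 2^-1)).
  - by move=> m; exact: normr_ge0.
  - move=> m; apply: le_trans (normr_ge0 _) _; last first.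
      by rewrite /= exprVn; exact: uB.
  - by move=> m; rewrite /= exprVn; exact: uB.
  - apply: is_cvg_geometric_series; rewrite ger0_norm ?invr_ge0//.
    by rewrite invf_lt1// ltr1n.
move=> h; apply: is_cvgD => //; exact: is_cvg_cst.
Qed.

(** Weighting the increments by 4^m keeps the sum G of 4^m |f_(m+1) - f_m|^2
integrable, hence finite almost everywhere; wherever G is finite, the increments
are at most (G + 1) / 2^m, so the sequence converges there. *)
Lemma rapidly_cauchy_ae_cvg (f_ : nat -> T -> R) (c : R) :
  (forall m, L2 mu (f_ m)) ->
  (forall m, L2_inner mu (f_ m.+1 - f_ m) (f_ m.+1 - f_ m) <= c / 16 ^+ m) ->
  exists2 E, measurable E & (\forall x \ae mu, E x) /\
    forall x, E x -> cvgn (f_ ^~ x).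
Proof.
move=> Lf fc; pose D m := f_ m.+1 - f_ m.
have LD m : L2 mu (D m) by exact: L2B.
pose g m x : \bar R := (4 ^+ m * D m x ^+ 2)%:E.
have g0 m x : (0 <= g m x)%E by rewrite lee_fin mulr_ge0 ?sqr_ge0// exprn_ge0.
have mg m : measurable_fun setT (g m).
  apply/measurable_EFinP; apply: measurable_funM => //.
  by apply: measurable_funX; exact: L2_measurable (LD m).
pose G x := (\sum_(m <oo) g m x)%E.
have mG : measurable_fun setT G by apply: ge0_emeasurable_sum.
have G0 x : (0 <= G x)%E by apply: nneseries_ge0.
have intG : (\int[mu]_x G x < +oo)%E.
  rewrite integral_nneseries//.
  apply: (@le_lt_trans _ _ (\sum_(m <oo) ((2 * c) / (2 ^ (m + 1))%:R)%:E)%E).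
    apply: lee_nneseries => [m _ _|m _].
      by apply: integral_ge0 => x _; exact: g0.
    under eq_integral do rewrite /g EFinM.
    have mD2 : measurable_fun setT (fun x => (D m x ^+ 2)%:E).
      apply/measurable_EFinP; apply: measurable_funX.
      exact: L2_measurable (LD m).
    rewrite ge0_integralZl_EFin ?exprn_ge0//; last first.
      by move=> x _; rewrite lee_fin sqr_ge0.
    rewrite -L2_innerE// -EFinM lee_fin.
    have c0 : 0 <= c.
      have := fc 0%N; rewrite expr0 divr1; apply: le_trans; exact: L2_inner_ge0.
    apply: le_trans (ler_wpM2l _ (fc m)) _; first exact: exprn_ge0.
    rewrite addn1 expnS natrM natrX.
    rewrite (_ : 16 = 4 * 4 :> R); last by rewrite -natrM.
    rewrite exprMn (_ : (4 : R) ^+ m = 2 ^+ m * 2 ^+ m); last first.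
      by rewrite -exprMn -natrM.
    have p2 : 1 <= 2 ^+ m :> R by rewrite exprn_ege1// ler1n.
    have p0 : 2 ^+ m != 0 :> R by rewrite gt_eqF// (lt_le_trans _ p2).
    rewrite [leLHS](_ : _ = c / 2 ^+ m / 2 ^+ m); last by field.
    rewrite [leRHS](_ : _ = c / 2 ^+ m); last by field.
    rewrite ler_pdivrMr ?(lt_le_trans _ p2)// ler_peMr//.
    by rewrite divr_ge0// ltW// (lt_le_trans _ p2).
  have /cvg_lim := @cvg_geometric_eseries_half R (2 * c) 0.
  move=> H; rewrite [X in (X < _)%E](_ : _ = (2 * c / 2 ^+ 0)%:E) ?ltry//.
  exact: H.
exists [set x | G x < +oo]%E.
  rewrite -[X in measurable X]setTI; by apply: emeasurable_fun_infty_o.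
split.
  have iG : mu.-integrable setT G.
    by apply/integrableP; split => //; under eq_integral do rewrite gee0_abs//.
  have := integrable_ae measurableT iG.
  by apply: filterS => x /(_ I); rewrite ge0_fin_numE.
move=> x /= Gx; apply: (@cvgn_geometric_increments _ (fine (G x) + 1)) => m.
have Gxf : G x \is a fin_num by rewrite ge0_fin_numE.
have F0 : 0 <= fine (G x) by apply: fine_ge0.
have : (g m x <= G x)%E.
  have := @nneseries_lim_ge R (fun m => g m x) xpredT 0 m.+1
    (fun n _ _ => g0 n x).
  apply: le_trans; rewrite big_nat_recr//= leeDr//; exact: sume_ge0.
rewrite -(fineK Gxf) lee_fin => gG.
rewrite ler_pdivlMr ?exprn_gt0//.
(* G <= (G + 1)^2 avoids square roots when passing from the square of the
   increment to the increment itself. *)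
rewrite -(ler_pXn2r (ltn0Sn 1)) ?nnegrE ?mulr_ge0 ?exprn_ge0 ?addr_ge0//.
rewrite exprMn real_normK ?num_real// -exprM mulnC exprM mulrC.
rewrite (_ : (2 : R) ^+ 2 = 4); last by rewrite -natrX.
apply: le_trans gG _; nra.
Qed.

(** Riesz-Fischer, for sequences whose rate of convergence is prescribed.  The
pointwise limit of f_k exists almost everywhere; Fatou's lemma, applied to
|f_k - f_m|^2 as k grows, bounds its distance to f_m, which also shows that it
is square-integrable. *)
Lemma L2_rapidly_cauchy_cvg (f_ : nat -> T -> R) (c : R) :
  (forall m, L2 mu (f_ m)) ->
  (forall m k, (m <= k)%N ->
     L2_inner mu (f_ k - f_ m) (f_ k - f_ m) <= c / 16 ^+ m) ->
  exists2 f, L2 mu f &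
    forall m, L2_inner mu (f - f_ m) (f - f_ m) <= c / 16 ^+ m.
Proof.
move=> Lf fc.
have LB m k : L2 mu (f_ k - f_ m) by exact: L2B.
have [E mE [aeE cE]] := rapidly_cauchy_ae_cvg Lf
  (fun m => fc m m.+1 (leqnSn m)).
(* Cutting off by the indicator of the convergence set E makes the sequence
   converge at every point, so that its limit is measurable. *)
pose g_ m : T -> R := f_ m \* \1_E.
have mg m : measurable_fun setT (g_ m).
  apply: measurable_funM; first exact: L2_measurable (Lf m).
  exact: measurable_indic.
have cg x : cvgn (g_ ^~ x).
  rewrite /g_/= indicE; have [xE|xE] := boolP (x \in E).
    under eq_fun do rewrite mulr1; apply: cE; exact/set_mem.
  under eq_fun do rewrite mulr0; exact: is_cvg_cst.
pose f x := limn (g_ ^~ x).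
have mf : measurable_fun setT f.
  by apply: (measurable_fun_cvg mg) => x _; exact: cg.
have fB m : (\int[mu]_x ((f x - f_ m x) ^+ 2)%:E <= (c / 16 ^+ m)%:E)%E.
  pose h k x : \bar R := ((g_ (k + m)%N x - f_ m x) ^+ 2)%:E.
  have mh k : measurable_fun setT (h k).
    apply/measurable_EFinP; apply: measurable_funX.
    apply: measurable_funB => //; exact: L2_measurable (Lf m).
  have h0 k x : setT x -> (0 <= h k x)%E by rewrite lee_fin sqr_ge0.
  rewrite [leLHS](_ : _ = \int[mu]_x limn_einf (h ^~ x))%E; last first.
    apply: eq_integral => x _; apply/esym.
    suff : h ^~ x @ \oo --> ((f x - f_ m x) ^+ 2)%:E.
      by move=> /cvg_limn_einf_sup[->].
    apply: cvg_EFin; first exact: nearW.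
    rewrite (_ : fine \o _ = fun k => (g_ (k + m)%N x - f_ m x) ^+ 2)//.
    have -> : (fun k => (g_ (k + m)%N x - f_ m x) ^+ 2) =
              (fun k => (g_ (k + m)%N x - f_ m x) * (g_ (k + m)%N x - f_ m x)).
      by apply/funext => k; rewrite expr2.
    have H : g_ (k + m)%N x - f_ m x @[k --> \oo] --> f x - f_ m x.
      apply: cvgB; last exact: cvg_cst.
      by have := cg x; rewrite -(@cvg_shiftn m).
    rewrite expr2; exact: cvgM.
  apply: le_trans (fatou mu measurableT mh h0) _.
  apply: limn_einf_le => k.
  rewrite (_ : (\int[mu]_x h k x)%E =
      \int[mu]_x (((f_ (k + m)%N - f_ m) x) ^+ 2)%:E)%E; last first.
    apply: ae_eq_integral => //.
      apply/measurable_EFinP; apply: measurable_funX.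
      exact: L2_measurable (LB _ _).
    apply: filterS aeE => x Ex _; rewrite /h /g_/= indicE mem_set//= mulr1.
    by [].
  by rewrite -L2_innerE// lee_fin; apply: fc; exact: leq_addl.
have LfB m : L2 mu (f - f_ m).
  apply/L2P; split.
    by apply: measurable_funB => //; exact: L2_measurable (Lf m).
  exact: le_lt_trans (fB m) (ltry _).
exists f.
  by rewrite -(subrK (f_ 0) f) -[f - f_ 0]scale1r; exact: L2_lin.
by move=> m; rewrite -lee_fin L2_innerE//; exact: fB.
Qed.

End L2_complete.

(** * Orthogonality and density in L^2(mu)^n *)

Section projection.
Context d (T : measurableType d) (R : realType).
Variables (mu : {measure set T -> \bar R}) (n : nat).
Implicit Types y w v : 'I_n -> T -> R.
Local Notation "'<< y , w >>" := (L2n_inner mu y w).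

Lemma L2n_lin c y w : L2n mu y -> L2n mu w -> L2n mu (c *: y + w).
Proof. by move=> Ly Lw k; exact: L2_lin (Ly k) (Lw k). Qed.

Lemma L2nB y w : L2n mu y -> L2n mu w -> L2n mu (y - w).
Proof. by move=> Ly Lw; rewrite addrC -scaleN1r; exact: L2n_lin. Qed.

Lemma L2n_innerC y w : '<<y, w>> = '<<w, y>>.
Proof. by apply: eq_bigr => k _; exact: L2_innerC. Qed.

Lemma L2n_inner_linl c y w v : L2n mu y -> L2n mu w -> L2n mu v ->
  '<<c *: y + w, v>> = c * '<<y, v>> + '<<w, v>>.
Proof.
move=> Ly Lw Lv; rewrite mulr_sumr -big_split; apply: eq_bigr => k _ /=.
exact: L2_inner_lin (Ly k) (Lw k) (Lv k).
Qed.

Lemma L2n_inner_linr c y w v : L2n mu y -> L2n mu w -> L2n mu v ->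
  '<<v, c *: y + w>> = c * '<<v, y>> + '<<v, w>>.
Proof.
by move=> Ly Lw Lv; rewrite L2n_innerC L2n_inner_linl// !(L2n_innerC v).
Qed.

Lemma L2n_inner_sq_lin c y w : L2n mu y -> L2n mu w ->
  '<<c *: y + w, c *: y + w>> =
  '<<w, w>> + 2 * c * '<<y, w>> + c ^+ 2 * '<<y, y>>.
Proof.
move=> Ly Lw; have Lyw := L2n_lin c Ly Lw.
rewrite L2n_inner_linl// !L2n_inner_linr// (L2n_innerC w y); ring.
Qed.

Lemma L2n_inner_ge0 y : 0 <= '<<y, y>>.
Proof. by apply: sumr_ge0 => k _; exact: L2_inner_ge0. Qed.

Lemma L2n_inner_component y k : L2_inner mu (y k) (y k) <= '<<y, y>>.
Proof.
rewrite /L2n_inner (bigD1 k)//= lerDl; apply: sumr_ge0 => j _.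
exact: L2_inner_ge0.
Qed.

Lemma L2n_inner_eq0 y : L2n mu y -> '<<y, y>> = 0 -> L2n_eq mu y (fun=> cst 0).
Proof.
move=> Ly y0 k; apply: L2_inner_eq0 (Ly k) _; apply/eqP.
by rewrite eq_le L2_inner_ge0 andbT -y0 L2n_inner_component.
Qed.

Lemma L2n_ae_inner0 y w : L2n mu y -> L2n mu w -> L2n_eq mu y (fun=> cst 0) ->
  '<<w, y>> = 0.
Proof. by move=> Ly Lw y0; apply: big1 => k _; exact: L2_ae_inner0. Qed.

(** A quadratic polynomial e + 2 b c + a c^2 that is nonnegative for every real c
has a nonpositive discriminant.  It gives both the Cauchy-Schwarz inequality and
the approximate orthogonality of an almost minimizer in the projection
theorem. *)
Lemma discriminant_le0 (a b e : R) : 0 <= a ->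
  (forall c, 0 <= e + 2 * c * b + c ^+ 2 * a) -> b ^+ 2 <= e * a.
Proof.
rewrite le_eqVlt => /predU1P[<- H|a0 H].
  have [->|b0] := eqVneq b 0; first by rewrite mulr0 expr0n.
  have := H (- (e + 1) / (2 * b)).
  rewrite [X in 0 <= X](_ : _ = -1); last by field.
  by rewrite ler0N1.
have := H (- b / a).
rewrite [X in 0 <= X](_ : _ = e - b ^+ 2 / a); last by field; rewrite gt_eqF.
by rewrite subr_ge0 ler_pdivrMr.
Qed.

Lemma L2n_cauchy_schwarz y w : L2n mu y -> L2n mu w ->
  '<<y, w>> ^+ 2 <= '<<w, w>> * '<<y, y>>.
Proof.
move=> Ly Lw; apply: discriminant_le0 => [|c]; first exact: L2n_inner_ge0.
by rewrite -L2n_inner_sq_lin// L2n_inner_ge0.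
Qed.

Lemma exists_geometric_lt (K e : R) : 0 < e -> exists m : nat, K / 16 ^+ m < e.
Proof.
move=> e0; have [K0|K0] := leP K 0.
  by exists 0%N; rewrite expr0 divr1 (le_lt_trans K0).
exists (Num.bound (K / e)); rewrite ltr_pdivrMr ?exprn_gt0//.
rewrite mulrC -ltr_pdivrMr//.
have /lt_trans -> // := archi_boundP (ltW (divr_gt0 K0 e0)).
by rewrite -natrX ltr_nat ltn_expl.
Qed.

Lemma L2n_rapidly_cauchy_cvg (y_ : nat -> 'I_n -> T -> R) (c : R) :
  (forall m, L2n mu (y_ m)) ->
  (forall m k, (m <= k)%N -> '<<y_ k - y_ m, y_ k - y_ m>> <= c / 16 ^+ m) ->
  exists2 y, L2n mu y &
    forall m, '<<y - y_ m, y - y_ m>> <= n%:R * c / 16 ^+ m.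
Proof.
move=> Ly yc.
have /choice[y Hy] j : exists f, L2 mu f /\ forall m,
    L2_inner mu (f - y_ m j) (f - y_ m j) <= c / 16 ^+ m.
  have [||f Lf fc] := @L2_rapidly_cauchy_cvg _ _ _ mu (fun m => y_ m j) c.
  - by move=> m; exact: Ly.
  - move=> m k mk; apply: le_trans (yc m k mk).
    exact: (L2n_inner_component (y_ k - y_ m) j).
  - by exists f.
exists y => [j|m]; first by have [] := Hy j.
apply: (@le_trans _ _ (\sum_(j < n) c / 16 ^+ m)).
  by apply: ler_sum => j _; have [_] := Hy j; exact.
by rewrite sumr_const card_ord -[leLHS]mulr_natl mulrA.
Qed.

(** The projection theorem.  A sequence s of points of S that minimizes the
distance to y is Cauchy by the parallelogram identity; if h is its limit, then
y - h is orthogonal to S, so that y - h = 0 and y is the limit of s.  Taking s m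
within 16^-m of the infimum gives the rate asked for by
[L2n_rapidly_cauchy_cvg]. *)
Lemma L2n_closure_trivial_orthogonal (S : set ('I_n -> T -> R)) :
  S `<=` @L2n _ _ _ mu n -> S 0 ->
  (forall c h h', S h -> S h' -> S (c *: h + h')) ->
  (forall y, L2n mu y -> (forall h, S h -> '<<h, y>> = 0) -> '<<y, y>> = 0) ->
  L2n_closure mu S = @L2n _ _ _ mu n.
Proof.
move=> SL S0 Slin Sorth; apply/seteqP; split=> [y []//|y Ly]; split => //.
pose D := [set '<<y - h, y - h>> | h in S].
have D0 : has_inf D.
  split; first by exists '<<y - 0, y - 0>>; exists 0.
  by exists 0 => _ [h _ <-]; exact: L2n_inner_ge0.
have Dinf h : S h -> inf D <= '<<y - h, y - h>>.
  by move=> Sh; apply: ge_inf; [exact: D0.2|exists h].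
have /choice[s Hs] m : exists h, S h /\
    '<<y - h, y - h>> < inf D + 1 / 16 ^+ m.
  have e0 : 0 < 1 / 16 ^+ m :> R by rewrite divr_gt0// exprn_gt0.
  by have [_ [h Sh <-] hm] := inf_adherent e0 D0; exists h.
have Ss m : S (s m) by have [] := Hs m.
have Ls m : L2n mu (s m) by exact: SL.
have sm m : '<<y - s m, y - s m>> < inf D + 1 / 16 ^+ m by have [] := Hs m.
have parallelogram m k : (m <= k)%N ->
    '<<s k - s m, s k - s m>> <= 4 / 16 ^+ m.
  move=> mk.
  (* The midpoint of s m and s k lies in S, hence no closer to y than inf D. *)
  have Sh : S (2^-1 *: s k + (- 2^-1 *: s m + s m)).
    by apply: (Slin) => //; exact: Slin.
  have := Dinf _ Sh.
  have -> : y - (2^-1 *: s k + (- 2^-1 *: s m + s m)) =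
      - 2^-1 *: (s k - s m) + (y - s m).
    rewrite scalerBr !scaleNr !opprD !opprK addrCA -addrA.
    by congr (_ + _); exact: addrCA.
  have := sm k; have -> : y - s k = -1 *: (s k - s m) + (y - s m).
    by rewrite scaleN1r opprB [RHS]addrC addrA subrK.
  have e2 : 1 / 16 ^+ k <= 1 / 16 ^+ m :> R.
    rewrite !div1r lef_pV2 ?posrE ?exprn_gt0//.
    by rewrite ler_weXn2l// ler1n.
  have := sm m; have Lw := L2nB Ly (Ls m); have Lv := L2nB (Ls k) (Ls m).
  rewrite !L2n_inner_sq_lin//.
  set V := '<<s k - s m, s k - s m>>; set W := '<<y - s m, y - s m>>.
  rewrite (_ : 4 / _ = 4 * (1 / 16 ^+ m)) ?mul1r//; lra.
have [h Lh hs] := L2n_rapidly_cauchy_cvg Ls parallelogram.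
have orth g : S g -> '<<g, y - h>> = 0.
  move=> Sg; have Lg := SL _ Sg.
  (* y - s m is orthogonal to g up to an error controlled by the gap between s m
     and the infimum, and h - s m is small by Cauchy-Schwarz. *)
  have bound m : '<<g, y - h>> ^+ 2 <=
      2 * (n%:R * 4 + 1) * '<<g, g>> / 16 ^+ m.
    have Lw := L2nB Ly (Ls m); have Lv := L2nB Lh (Ls m).
    have b1 : '<<g, y - s m>> ^+ 2 <= 1 / 16 ^+ m * '<<g, g>>.
      apply: discriminant_le0 => [|c]; first exact: L2n_inner_ge0.
      have := Dinf _ (Slin (- c) _ _ Sg (Ss m)).
      have -> : y - (- c *: g + s m) = c *: g + (y - s m).
        by rewrite opprD scaleNr opprK addrCA.
      rewrite L2n_inner_sq_lin//; have := sm m; lra.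
    have b2 := L2n_cauchy_schwarz Lg Lv.
    have : '<<g, y - h>> = '<<g, y - s m>> - '<<g, h - s m>>.
      rewrite (_ : y - h = -1 *: (h - s m) + (y - s m)); last first.
        by rewrite scaleN1r opprB [RHS]addrC addrA subrK.
      by rewrite L2n_inner_linr// mulN1r addrC.
    move=> ->.
    have b3 : '<<g, h - s m>> ^+ 2 <= n%:R * 4 / 16 ^+ m * '<<g, g>>.
      by apply: le_trans b2 _; rewrite ler_wpM2r// L2n_inner_ge0.
    rewrite [leRHS](_ : _ = 2 * (1 / 16 ^+ m * '<<g, g>>) +
        2 * (n%:R * 4 / 16 ^+ m * '<<g, g>>)); last by ring.
    set p := '<<g, y - s m>> in b1 *; set q := '<<g, h - s m>> in b3 *.
    have pq : 0 <= (p + q) ^+ 2 by exact: sqr_ge0.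
    have -> : (p - q) ^+ 2 = 2 * p ^+ 2 + 2 * q ^+ 2 - (p + q) ^+ 2 by ring.
    lra.
  apply/eqP; rewrite -sqrf_eq0 eq_le sqr_ge0 andbT; apply/ler_addgt0Pl => e e0.
  have [m Km] := exists_geometric_lt (2 * (n%:R * 4 + 1) * '<<g, g>>) e0.
  by rewrite addr0 (le_trans (bound m))// ltW.
have yh0 := Sorth _ (L2nB Ly Lh) orth.
move=> e e0.
have [m Km] := exists_geometric_lt (n%:R * 4) (exprn_gt0 2 e0).
exists (s m) => //.
rewrite /L2n_norm -[e]ger0_norm ?ltW// -sqrtr_sqr ltr_sqrt ?exprn_gt0//.
change ('<<y - s m, y - s m>> < e ^+ 2).
rewrite (_ : y - s m = 1 *: (y - h) + (h - s m)); last first.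
  by rewrite scale1r addrA subrK.
have Lyh := L2nB Ly Lh; have Lhs := L2nB Lh (Ls m).
rewrite L2n_inner_sq_lin// yh0 mulr0 addr0.
rewrite L2n_innerC (L2n_ae_inner0 Lyh Lhs (L2n_inner_eq0 Lyh yh0)) mulr0 addr0.
exact: le_lt_trans (hs m) Km.
Qed.

(** Approximating y by h in S within the norm of y itself would give
<y, y>^2 = <y - h, y>^2 <= |y - h|^2 |y|^2 < |y|^4 if y were nonzero. *)
Lemma L2n_closure_orthogonal (S : set ('I_n -> T -> R)) y :
  S `<=` @L2n _ _ _ mu n -> L2n_closure mu S y ->
  (forall h, S h -> '<<h, y>> = 0) -> '<<y, y>> = 0.
Proof.
move=> SL [Ly Sy] orth; apply/eqP; rewrite eq_le L2n_inner_ge0 andbT leNgt.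
apply/negP => y0.
have ny0 : 0 < L2n_norm mu y by rewrite sqrtr_gt0.
have [h Sh] := Sy _ ny0; rewrite ltr_sqrt// => yh.
have Lh := SL _ Sh; have Lyh := L2nB Ly Lh.
have yyE : '<<y, y>> = '<<y - h, y>>.
  have {1}-> : y = 1 *: (y - h) + h by rewrite scale1r subrK.
  by rewrite L2n_inner_linl// mul1r (orth h)// addr0.
have := L2n_cauchy_schwarz Lyh Ly; rewrite -yyE expr2 ler_pM2l// leNgt.
by rewrite [X in ~~ X]yh.
Qed.

End projection.

(** * Square-integrable functions of time with values in a Hilbert space *)

Section bochner_theory.
Context d (T : measurableType d) (R : realType).
Variables (mu : {measure set T -> \bar R}).
Variables (V : completeNormedModType R) (ip : {dot V for idfun}).
Hypothesis ip_norm : forall x : V, ip x x = `|x| ^+ 2.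
Implicit Types (x y v : V) (s z w : T -> V).

Lemma vsimple_lin c s s' : vsimple s -> vsimple s' -> vsimple (c *: s + s').
Proof.
move=> [m [A [v [mA ->]]]] [m' [A' [v' [mA' ->]]]].
exists (m + m')%N,
  (fun j : 'I_(m + m') => match fintype.split j with
     inl i => A i | inr i => A' i end),
  (fun j : 'I_(m + m') => match fintype.split j with
     inl i => c *: v i | inr i => v' i end).
split; first by move=> j; case: fintype.split.
apply/funext => t; rewrite big_split_ord/= [LHS](_ : _ =
    c *: (\sum_j (\1_(A j) t : R) *: v j) + \sum_j (\1_(A' j) t : R) *: v' j)//.
rewrite scaler_sumr; congr (_ + _); apply: eq_bigr => i _.
  by rewrite (unsplitK (inl i)) !scalerA mulrC.
by rewrite (unsplitK (inr i)).
Qed.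

Lemma strongly_measurable_lin c z w : strongly_measurable z ->
  strongly_measurable w -> strongly_measurable (c *: z + w).
Proof.
move=> [s_ [ss sz]] [s'_ [ss' sz']]; exists (fun m => c *: s_ m + s'_ m).
split=> [m|t]; first exact: vsimple_lin.
exact: (cvgD (cvgZ (cvg_cst c) (sz t)) (sz' t)).
Qed.

(** The target space carries no sigma-algebra here, so the measurability of the
norm of a simple function is obtained by splitting along one set A j at a time;
the constant x accumulates the values of the sets already treated. *)
Lemma vsimple_norm_measurable s : vsimple s ->
  measurable_fun setT (fun t => `|s t|).
Proof.
move=> [m [A [v [mA ->]]]].
suff : forall x, measurable_fun setT
    (fun t => `|x + \sum_(j < m) (\1_(A j) t : R) *: v j|).
  by move=> /(_ 0); under eq_fun do rewrite add0r.
elim: m A v mA => [A v mA x|m IH A v mA x].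
  by under eq_fun do rewrite big_ord0; exact: measurable_cst.
rewrite (_ : (fun t => _) = (fun t => if t \in A ord0
    then `|(x + v ord0) +
           \sum_(j < m) (\1_(A (lift ord0 j)) t : R) *: v (lift ord0 j)|
    else `|x + \sum_(j < m) (\1_(A (lift ord0 j)) t : R) *: v (lift ord0 j)|)).
  apply: measurable_fun_ifT.
  - apply: (measurable_fun_bool true).
    rewrite setTI (_ : _ @^-1` _ = A ord0)//.
    by apply/seteqP; split => t /=; [exact: set_mem|exact: mem_set].
  - exact: (IH (fun j => A (lift ord0 j)) (fun j => v (lift ord0 j))).
  - exact: (IH (fun j => A (lift ord0 j)) (fun j => v (lift ord0 j))).
apply/funext => t; rewrite big_ord_recl indicE.
by case: ifPn => _; rewrite ?scale1r ?scale0r ?add0r ?addrA.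
Qed.

Lemma strongly_measurable_norm z : strongly_measurable z ->
  measurable_fun setT (fun t => `|z t|).
Proof.
move=> [s_ [ss sz]].
apply: (@measurable_fun_cvg _ _ _ _ (fun m t => `|s_ m t|)).
  by move=> m; exact: vsimple_norm_measurable.
by move=> t _; apply: cvg_norm; exact: sz.
Qed.

Lemma bochner_L2_0 : bochner_L2 mu (0 : T -> V).
Proof.
split.
  exists (fun=> 0); split=> [m|t]; last exact: cvg_cst.
  exists 0%N, (fun=> set0), (fun=> 0); split => //.
  by apply/funext => t; rewrite big_ord0.
by under eq_integral do rewrite normr0 expr0n; rewrite integral0.
Qed.

Lemma bochner_L2_integrable z : bochner_L2 mu z ->
  mu.-integrable setT (fun t => (`|z t| ^+ 2)%:E).
Proof.
move=> [mz zy]; apply/integrableP; split.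
  apply/measurable_EFinP; apply: measurable_funX.
  exact: strongly_measurable_norm.
by under eq_integral do rewrite gee0_abs ?lee_fin ?sqr_ge0//.
Qed.

Lemma normD_sq_le x y : `|x + y| ^+ 2 <= 2 * `|x| ^+ 2 + 2 * `|y| ^+ 2.
Proof.
apply: (@le_trans _ _ ((`|x| + `|y|) ^+ 2)).
  by rewrite ler_pXn2r// ?nnegrE ?addr_ge0//; exact: ler_normD.
rewrite -subr_ge0 (_ : _ - _ = (`|x| - `|y|) ^+ 2) ?sqr_ge0//; ring.
Qed.

Lemma bochner_L2_lin c z w : bochner_L2 mu z -> bochner_L2 mu w ->
  bochner_L2 mu (c *: z + w).
Proof.
move=> Lz Lw; have mzw := strongly_measurable_lin c Lz.1 Lw.1; split => //.
have Iz := integrableZl measurableT (2 * `|c| ^+ 2) (bochner_L2_integrable Lz).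
have Iw := integrableZl measurableT 2 (bochner_L2_integrable Lw).
have /integrableP[_] := integrableD measurableT Iz Iw.
apply: le_lt_trans; apply: ge0_le_integral => //.
- apply/measurable_EFinP; apply: measurable_funX.
  exact: (strongly_measurable_norm mzw).
- apply: measurableT_comp => //; apply: emeasurable_funD.
    exact: measurable_int Iz.
  exact: measurable_int Iw.
- move=> t _; rewrite -!EFinM -EFinD lee_fin ger0_norm.
    by apply: le_trans (normD_sq_le _ _) _; rewrite normrZ exprMn mulrA.
  by rewrite addr_ge0// !mulr_ge0// ?sqr_ge0.
Qed.

Lemma ipC x y : ip x y = ip y x.
Proof. by rewrite hermC expr0 mul1r. Qed.

Lemma ip_linr c x y v : ip v (c *: x + y) = c * ip v x + ip v y.
Proof. by rewrite linearPr. Qed.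

(** Polarization expresses the inner product by norms, and so carries
measurability and integrability over from norms to inner products. *)
Lemma ip_polarization x y :
  ip x y = 2^-1 * (`|x + y| ^+ 2 - (`|x| ^+ 2 + `|y| ^+ 2)).
Proof.
rewrite -!ip_norm linearDl/= !linearDr/= (ipC y x); by field.
Qed.

Lemma ip_le x y : `|ip x y| <= `|x| ^+ 2 + `|y| ^+ 2.
Proof.
have h u : 0 <= `|u : V| ^+ 2 by exact: sqr_ge0.
have /= := ip_polarization x y; have := h (x + y); have := normD_sq_le x y.
have := h x; have := h y.
by move=> *; rewrite ler_norml; apply/andP; split; lra.
Qed.

Lemma bochner_ip_integrable z w : bochner_L2 mu z -> bochner_L2 mu w ->
  mu.-integrable setT (EFin \o (fun t => ip (z t) (w t))).
Proof.
move=> Lz Lw.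
have Izw := integrableD measurableT (bochner_L2_integrable Lz)
  (bochner_L2_integrable Lw).
apply: (le_integrable measurableT _ _ Izw); last first.
  move=> t _; rewrite -EFinD lee_fin.
  rewrite [leRHS]ger0_norm ?addr_ge0 ?sqr_ge0//; exact: ip_le.
apply/measurable_EFinP; under eq_fun do rewrite ip_polarization.
have m2 (u : T -> V) : strongly_measurable u ->
    measurable_fun setT (fun t => `|u t| ^+ 2 : R).
  by move=> mu_; apply: measurable_funX; exact: (strongly_measurable_norm mu_).
apply: measurable_funM => //; apply: measurable_funB; last first.
  by apply: measurable_funD; apply: m2; [exact: Lz.1|exact: Lw.1].
rewrite (_ : (fun t => _) = fun t => `|(1 *: z + w) t| ^+ 2).
  by apply: m2; apply: strongly_measurable_lin; [exact: Lz.1|exact: Lw.1].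
by apply/funext => t; rewrite scale1r.
Qed.

Local Notation "'<< z , w >>" := (bochner_inner mu ip z w).

Lemma bochner_inner_linr c z z' w : bochner_L2 mu z -> bochner_L2 mu z' ->
  bochner_L2 mu w -> '<<w, c *: z + z'>> = c * '<<w, z>> + '<<w, z'>>.
Proof.
move=> Lz Lz' Lw; have I := bochner_ip_integrable Lw Lz.
have I' := bochner_ip_integrable Lw Lz'.
rewrite /bochner_inner -RintegralZl// -RintegralD//.
  by apply: eq_Rintegral => t _; exact: ip_linr.
have := integrableZl measurableT c I.
by apply: eq_integrable => // t _.
Qed.

Lemma bochner_inner_ge0 z : 0 <= '<<z, z>>.
Proof. by apply: Rintegral_ge0 => t _; rewrite ip_norm sqr_ge0. Qed.

Lemma bochner_inner0 w : '<<w, 0>> = 0.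
Proof.
rewrite /bochner_inner; under eq_Rintegral do rewrite linear0r.
by rewrite Rintegral_cst// mul0r.
Qed.

Lemma bochner_inner_eq0 z : bochner_L2 mu z -> '<<z, z>> = 0 ->
  forall w, bochner_L2 mu w -> '<<w, z>> = 0.
Proof.
move=> Lz zz w Lw.
have I := bochner_ip_integrable Lz Lz.
have zz' : (\int[mu]_t `|(ip (z t) (z t))%:E| = 0)%E.
  have := integrable_fin_num measurableT I.
  move=> /fineK; rewrite -[fine _]/('<<z, z>>) zz => H; apply: etrans (esym H).
  by apply: eq_integral => t _; rewrite gee0_abs// lee_fin ip_norm sqr_ge0.
have /ae_eq_integral_abs := zz' => /= H.
have {}H := H measurableT (measurable_int mu I).
rewrite -(bochner_inner0 w); congr fine; apply: ae_eq_integral => //.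
- exact: measurable_int (bochner_ip_integrable Lw Lz).
- exact: measurable_int (bochner_ip_integrable Lw bochner_L2_0).
apply: filterS H => t /= /(_ Logic.I) [/eqP].
by rewrite ip_norm sqrf_eq0 normr_eq0 => /eqP -> _.
Qed.

End bochner_theory.

(** * Linearity of the gradient on H^1_0 *)

Section test_functions.
Variables (R : realType) (n : nat).
Local Notation Rn := 'rV[R]_n.
Implicit Types f g : Rn -> R.

Lemma partial_lin k c f g : (forall x, derivable f x (basis_vec R k)) ->
  (forall x, derivable g x (basis_vec R k)) ->
  partial k (c *: f + g) = c *: partial k f + partial k g.
Proof.
move=> df dg; apply/funext => x; rewrite /partial deriveD//; last first.
  exact: derivableZ.
by rewrite deriveZ.
Qed.

Lemma Cm_lin m c f g : Cm m f -> Cm m g -> Cm m (c *: f + g).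
Proof.
elim: m f g => [f g [cf _] [cg _]|m IH f g [cf Df] [cg Dg]].
  by split => // x; exact: (cvgD (cvgZ (cvg_cst c) (cf x)) (cg x)).
split=> [x|k]; first exact: (cvgD (cvgZ (cvg_cst c) (cf x)) (cg x)).
have [df Cf] := Df k; have [dg Cg] := Dg k; split.
  by move=> x; apply: derivableD; [exact: derivableZ (df x)|exact: dg].
by rewrite partial_lin//; exact: IH.
Qed.

Lemma Cm_0 m : Cm m (0 : Rn -> R).
Proof.
have c0 : continuous (0 : Rn -> R) by exact: cst_continuous.
elim: m => [//|m IH]; split=> // k.
split=> [x|]; first exact: derivable_cst.
rewrite (_ : partial k 0 = 0)//; apply/funext => x; exact: derive_cst.
Qed.

Variable Omega : set Rn.

Lemma test_function_0 : test_function Omega 0.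
Proof.
have s0 : [set x : Rn | (0 : Rn -> R) x != 0] = set0.
  by apply/seteqP; split => x //=; rewrite eqxx.
split; [by move=> m; exact: Cm_0| |]; rewrite s0 closure0//.
exact: compact0.
Qed.

Lemma test_function_lin c f g :
  test_function Omega f -> test_function Omega g ->
  test_function Omega (c *: f + g).
Proof.
move=> [Cf Kf Sf] [Cg Kg Sg].
have sub : closure [set x | (c *: f + g) x != 0] `<=`
    closure [set x | f x != 0] `|` closure [set x | g x != 0].
  rewrite -closureU; apply: closure_subset => x /= fg0.
  have [f0|f0] := eqVneq (f x) 0; [right|by left].
  apply: contra fg0 => /eqP g0.
  by rewrite !fctE f0 g0 scaler0 addr0.
split; first by move=> m; exact: Cm_lin.
  apply: subclosed_compact sub; first exact: closed_closure.
  exact: compactU.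
by move=> x /sub[/Sf|/Sg].
Qed.

Lemma partial_test_function_lin k c f g :
  test_function Omega f -> test_function Omega g ->
  partial k (c *: f + g) = c *: partial k f + partial k g.
Proof.
by move=> [/(_ 1%N) [_ Df] _ _] [/(_ 1%N) [_ Dg] _ _]; apply: partial_lin;
  [have [] := Df k|have [] := Dg k].
Qed.

End test_functions.

Section bounded_domain.
Variables (R : realType) (n : nat).
Local Notation Rn := 'rV[R]_n.

Lemma lebesgue_rV_bounded (A : set Rn) : measurable A -> bounded_set A ->
  (lebesgue_rV R n A < +oo)%E.
Proof.
move=> mA [M [_ AM]]; pose B (i : 'I_n) : set R := [set` `[- (M + 1), M + 1]].
have mB i : measurable (B i) by exact: measurable_itv.
have mbox : measurable [set v : Rn | forall i, B i (v ord0 i)].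
  rewrite (_ : mkset _ = \bigcap_(i in [set` 'I_n])
      ((fun v : Rn => v ord0 i) @^-1` B i)); last first.
    by rewrite eqEsubset; split => v /= H i; [move=> _; exact: H|exact: H].
  apply: fin_bigcap_measurable => // i _; rewrite -[X in measurable X]setTI.
  by apply: continuous_measurable_rV => //; exact: coord_continuous.
apply: (@le_lt_trans _ _ (lebesgue_rV R n [set v | forall i, B i (v ord0 i)])).
  apply: le_measure; rewrite ?inE// => v Av i.
  have /AM : M < M + 1 by rewrite ltrDl.
  move=> /(_ v Av); rewrite /B /= in_itv/= -ler_norml; apply: le_trans.
  rewrite /Num.norm/= mx_normrE.
  exact: (le_bigmax _ (fun ij => `|v ij.1 ij.2|) (ord0, i)).
rewrite lebesgue_rV_prod//.
rewrite ltey_eq; apply/orP; left.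
elim/big_ind : _ => [//|x y|i _]; first exact: fin_numM.
by rewrite lebesgue_measure_itv; case: ifP.
Qed.

Variables (Omega : set Rn) (oOmega : open Omega).
Hypothesis bOmega : bounded_set Omega.
Local Notation mu := (mu_open oOmega).

Lemma mu_open_ae : \forall x \ae mu, Omega x.
Proof.
exists (~` Omega); split.
- by apply: measurableC; exact: open_measurable_rV.
- by rewrite /= /mu_open /lebesgue_on /= /mrestr setICl measure0.
- by move=> x.
Qed.

Lemma continuous_bounded_on (f : Rn -> R) : continuous f ->
  exists K, forall x, Omega x -> `|f x| <= K.
Proof.
move=> cf; have [M [_ OM]] := bOmega.
pose M' := Num.max M 0 + 1.
have M0 : 0 < M' by rewrite ltr_wpDl// le_max lexx orbT.
have cpt : compact (closed_ball (0 : Rn) M').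
  apply: bounded_closed_compact; last exact: closed_ball_closed.
  exists M'; split; first exact: num_real.
  move=> y My x; rewrite closed_ballE// /closed_ball_/= sub0r normrN.
  by move=> /le_trans; apply; exact: ltW.
have /compact_bounded[K [_ HK]] :
    compact (f @` closed_ball (0 : Rn) M').
  apply: continuous_compact => //; exact: continuous_subspaceT.
exists (K + 1) => x Ox; apply: (HK (K + 1)); first by rewrite ltrDl.
exists x => //; rewrite closed_ballE// /closed_ball_/= sub0r normrN.
apply: (OM M') => //; rewrite /M'; apply: (@le_lt_trans _ _ (Num.max M 0)).
  by rewrite le_max lexx.
by rewrite ltrDl.
Qed.

(** It puts test functions and their partial derivatives in L^2(Omega), so that
the integrals defining weak derivatives converge and are linear in u and g. *)
Lemma continuous_L2 (f : Rn -> R) : continuous f -> L2 mu f.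
Proof.
move=> cf; have mf := continuous_measurable_rV cf.
have [K fK] := continuous_bounded_on cf.
apply/L2P; split => //.
apply: (@le_lt_trans _ _ (\int[mu]_x (cst (K ^+ 2)%:E x))%E).
  apply: ae_ge0_le_integral => //.
  - by move=> x _; rewrite lee_fin sqr_ge0.
  - by apply/measurable_EFinP; exact: measurable_funX.
  - by move=> x _; rewrite lee_fin sqr_ge0.
  apply: filterS mu_open_ae => x Ox _; rewrite lee_fin /=.
  rewrite -[f x ^+ 2]real_normK ?num_real// ler_pXn2r ?nnegrE//.
    exact: fK.
  exact: le_trans (fK _ Ox).
rewrite integral_cst//= lte_mul_pinfty ?lee_fin ?sqr_ge0//.
rewrite /mu_open /lebesgue_on /= /mrestr setTI.
apply: lebesgue_rV_bounded => //.
exact: open_measurable_rV.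
Qed.

Lemma test_function_partial_L2 k f : test_function Omega f ->
  L2 mu (partial k f).
Proof.
move=> [/(_ 1%N) [_ Df] _ _]; have [_ [cf _]] := Df k; exact: continuous_L2.
Qed.

Lemma test_function_L2 f : test_function Omega f -> L2 mu f.
Proof. by move=> [/(_ 0%N) [cf _] _ _]; exact: continuous_L2. Qed.

Lemma weak_gradient_0 : weak_gradient oOmega 0 0.
Proof.
split=> [|k|k f _]; [exact: L2_0|exact: L2_0|].
rewrite /GRing.zero/=; under eq_Rintegral do rewrite mul0r.
under [in RHS]eq_Rintegral do rewrite mul0r.
by rewrite Rintegral_cst// mul0r oppr0.
Qed.

Lemma weak_gradient_lin c u g u' g' : weak_gradient oOmega u g ->
  weak_gradient oOmega u' g' ->
  weak_gradient oOmega (c *: u + u') (c *: g + g').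
Proof.
move=> [Lu Lg ug] [Lu' Lg' ug']; split; [exact: L2_lin|exact: L2n_lin|].
move=> k f tf; have Lf := test_function_L2 tf.
have Ldf := test_function_partial_L2 k tf.
have := L2_inner_lin c Lu Lu' Ldf; have := L2_inner_lin c (Lg k) (Lg' k) Lf.
rewrite /L2_inner => H -> ; rewrite ug// ug'//.
by rewrite [in RHS]H opprD mulrN.
Qed.

Lemma H10_0 : H10 oOmega 0.
Proof.
exists 0; first exact: weak_gradient_0.
exists (fun=> 0); split=> [m||k].
- exact: test_function_0.
- exact: L2_cvg_cst.
- rewrite (_ : partial k 0 = 0); first exact: L2_cvg_cst.
  by apply/funext => x; exact: derive_cst.
Qed.

Lemma H10_lin c u u' :
  H10 oOmega u -> H10 oOmega u' -> H10 oOmega (c *: u + u').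
Proof.
move=> [g wg [f_ [tf fu fg]]] [g' wg' [f'_ [tf' fu' fg']]].
exists (c *: g + g'); first exact: weak_gradient_lin.
have [Lu Lg _] := wg; have [Lu' Lg' _] := wg'.
exists (fun m => c *: f_ m + f'_ m); split=> [m||k].
- exact: test_function_lin.
- by apply: L2_cvg_lin => // m; exact: test_function_L2.
- rewrite (_ : (fun m => _) =
      fun m => c *: partial k (f_ m) + partial k (f'_ m)); last first.
    by apply/funext => m; exact: partial_test_function_lin (tf m) (tf' m).
  by apply: L2_cvg_lin => // m; exact: test_function_partial_L2.
Qed.

Lemma grad_0 : grad oOmega 0 0.
Proof. by split; [exact: H10_0|exact: weak_gradient_0]. Qed.

Lemma grad_lin c u g u' g' : grad oOmega u g -> grad oOmega u' g' ->
  grad oOmega (c *: u + u') (c *: g + g').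
Proof.
by move=> [? ?] [? ?]; split; [exact: H10_lin|exact: weak_gradient_lin].
Qed.

End bounded_domain.

(** * Restriction to a subregion *)

Section restriction.
Variables (R : realType) (n : nat).
Local Notation Rn := 'rV[R]_n.
Variables (Omega : set Rn) (oOmega : open Omega).
Variables (omega : set Rn) (momega : measurable omega).
Hypothesis omega_Omega : omega `<=` Omega.
Local Notation mu := (mu_open oOmega).
Local Notation nu := (mu_sub momega).

Lemma integral_mu_sub (f : Rn -> \bar R) :
  (\int[nu]_(x in omega) f x = \int[mu]_(x in omega) f x)%E.
Proof.
apply: eq_measure_integral => A _ Ao.
rewrite /mu_sub /mu_open /lebesgue_on /= /mrestr !setIidl//.
exact: subset_trans Ao omega_Omega.
Qed.

Lemma L2_patch u : L2 mu u -> L2 nu (patch (cst 0) omega u).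
Proof.
move=> /L2P[mf uy]; apply/L2P; split.
  exact: (measurable_restrictT u momega).1 (measurable_funTS mf).
rewrite [ltLHS](_ : _ = \int[nu]_(x in omega) (u x ^+ 2)%:E)%E; last first.
  rewrite [RHS]integral_mkcond; apply: eq_integral => x _.
  by rewrite !patchE; case: ifP => //; rewrite expr0n.
rewrite integral_mu_sub; apply: le_lt_trans uy.
apply: ge0_subset_integral => //.
- by apply/measurable_EFinP; exact: measurable_funX.
- by move=> x _; rewrite lee_fin sqr_ge0.
Qed.

Lemma L2n_chi g : L2n mu g -> L2n nu (chi omega g).
Proof. by move=> Lg k; exact: L2_patch. Qed.

(** Both sides are the integral of y . g over omega. *)
Lemma chi_adj_inner (y g : 'I_n -> Rn -> R) :
  L2n_inner mu (chi_adj omega y) g = L2n_inner nu (chi omega g) y.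
Proof.
apply: eq_bigr => k _; rewrite /L2_inner.
transitivity (\int[mu]_(x in omega) (y k x * g k x)).
  rewrite [RHS]Rintegral_mkcond; apply: eq_Rintegral => x _.
  by rewrite /chi_adj !patchE; case: ifP => //; rewrite mul0r.
transitivity (\int[nu]_(x in omega) (y k x * g k x)).
  by rewrite /Rintegral integral_mu_sub.
rewrite Rintegral_mkcond; apply: eq_Rintegral => x _.
by rewrite /chi !patchE; case: ifP; rewrite ?mul0r// mulrC.
Qed.

Lemma chi_lin c (g g' : 'I_n -> Rn -> R) :
  chi omega (c *: g + g') = c *: chi omega g + chi omega g'.
Proof.
apply/funext => k; apply/funext => x.
rewrite /chi !fctE !patchE; case: ifP => //.
by rewrite scaler0 addr0.
Qed.

Lemma chi_0 : chi omega (0 : 'I_n -> Rn -> R) = 0.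
Proof.
by apply/funext => k; apply/funext => x; rewrite /chi !patchE; case: ifP.
Qed.

End restriction.

(** * The operator H, its adjoint and the four assertions *)

Section observability_theory.
Variables (R : realType) (n : nat).
Local Notation Rn := 'rV[R]_n.
Variables (Omega : set Rn) (oOmega : open Omega).
Hypothesis bOmega : bounded_set Omega.
Variables (lambda : nat -> R) (r : nat -> nat) (phi : nat -> nat -> Rn -> R).
Variables (alpha T : R).
Variables (O : completeNormedModType R) (ip : {dot O for idfun}).
Hypothesis ip_norm : forall x : O, ip x x = `|x| ^+ 2.
Variable C : observation_operator (mu_open oOmega) O.
Variables (omega : set Rn) (momega : measurable omega).
Hypothesis omega_Omega : omega `<=` Omega.
Local Notation mu := (mu_open oOmega).
Local Notation nu := (mu_sub momega).
Local Notation Kstar := (K_adj lambda r phi alpha T ip C).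
Local Notation H := (H_op lambda r phi alpha T ip C momega).
Local Notation Hstar := (H_adj lambda r phi alpha T ip C momega).

Lemma K_adj_0 : Kstar 0 0.
Proof.
split; [exact: bochner_L2_0|exact: L2_0|move=> u z [Lu Lz _]].
rewrite [LHS]bochner_inner0; apply/esym.
rewrite /L2_inner; under eq_Rintegral do rewrite mulr0.
by rewrite Rintegral_cst// mul0r.
Qed.

Lemma K_adj_lin c z z' v v' : Kstar z v -> Kstar z' v' ->
  Kstar (c *: z + z') (c *: v + v').
Proof.
move=> [Lz Lv zv] [Lz' Lv' zv']; split.
- exact: bochner_L2_lin.
- exact: L2_lin.
- move=> u w Kuw; have [Lu Lw _] := Kuw.
  rewrite /L2O_inner (bochner_inner_linr ip_norm)//.
  rewrite L2_innerC L2_inner_lin// !(L2_innerC _ _ u).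
  by congr (_ * _ + _); [exact: zv|exact: zv'].
Qed.

Lemma H_op_L2O z h : H z h -> L2O T z.
Proof. by move=> [_ [v [g [[]]]]]. Qed.

Lemma H_op_chi z v g : Kstar z v -> grad oOmega v g -> H z (chi omega g).
Proof.
move=> zv vg; have [_ [_ Lg _]] := vg; split.
  exact: (L2n_chi momega omega_Omega Lg).
by exists v, g; split => // k; exact: nearW.
Qed.

Lemma H_op_0 : H 0 0.
Proof.
by rewrite -(chi_0 omega); apply: H_op_chi K_adj_0 _; exact: grad_0.
Qed.

Lemma H_op_lin c z z' h h' : H z h -> H z' h' -> H (c *: z + z') (c *: h + h').
Proof.
move=> [Lh [v [g [zv vg hg]]]] [Lh' [v' [g' [zv' vg' hg']]]].
split; first exact: L2n_lin.
exists (c *: v + v'), (c *: g + g'); split.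
- exact: K_adj_lin.
- exact: grad_lin.
- move=> k; rewrite chi_lin; apply: filterS2 (hg k) (hg' k) => x hx hx' _.
  by rewrite !fctE hx// hx'.
Qed.

Lemma image_H_op_L2n : image_of H `<=` @L2n _ _ _ nu n.
Proof. by move=> h [z []]. Qed.

Lemma H_adj_0P y : L2n nu y ->
  Hstar y 0 <-> forall h, image_of H h -> L2n_inner nu h y = 0.
Proof.
move=> Ly; split=> [[_ _ y0] h [z zh]|y0].
  by rewrite (y0 z h zh); exact: bochner_inner0.
split; [exact: Ly|exact: bochner_L2_0|move=> z h zh].
by rewrite y0; [rewrite [RHS]bochner_inner0|exists z].
Qed.

Lemma orthogonal_image_HP y : L2n nu y ->
  (forall h, image_of H h -> L2n_inner nu h y = 0) <->
  (forall z v g, L2O T z -> Kstar z v -> grad oOmega v g ->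
     L2n_inner mu (chi_adj omega y) g = 0).
Proof.
move=> Ly; split=> [y0 z v g _ zv vg|y0 h [z [Lh [v [g [zv vg hg]]]]]].
  by rewrite chi_adj_inner//; apply: y0; exists z; exact: H_op_chi zv vg.
have [Lz _ _] := zv; have [_ [_ Lg _]] := vg.
rewrite -(y0 z v g Lz zv vg) chi_adj_inner//.
apply: eq_bigr => k _; apply: L2_inner_ae (Lh k) _ (Ly k) (hg k).
exact: (L2n_chi momega omega_Omega Lg).
Qed.

Lemma approx_G_observable_kernel :
  approx_G_observable lambda r phi alpha T ip C momega ->
  H_adj_kernel lambda r phi alpha T ip C momega = L2n_zero momega.
Proof.
move=> dense; apply/seteqP; split=> y.
  move=> ker; have [Ly _ _] := ker; split => //.
  apply: L2n_inner_eq0 => //.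
  apply: (L2n_closure_orthogonal image_H_op_L2n); last exact/(H_adj_0P Ly).
  by rewrite [L2n_closure _ _]dense.
move=> [Ly y0]; apply/(H_adj_0P Ly) => h /image_H_op_L2n Lh.
exact: L2n_ae_inner0.
Qed.

(** <H H* y, y> = <H* y, H* y>, and a z with <z, z> = 0 is orthogonal to all of
L^2(0,T;O), so that (y, 0) belongs to the graph of H* as soon as (y, z) does. *)
Lemma kernel_positive_definite :
  H_adj_kernel lambda r phi alpha T ip C momega = L2n_zero momega ->
  HHadj_positive_definite lambda r phi alpha T ip C momega.
Proof.
move=> ker y h [z Hyz Hzh] yN0; have [Ly Lz yz] := Hyz.
rewrite (yz z h Hzh) lt_neqAle [X in _ && X](bochner_inner_ge0 _ ip_norm) andbT.
apply/eqP => /esym zz; apply: yN0; rewrite -ker.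
apply/(H_adj_0P Ly) => h' [z' zh'].
rewrite (yz z' h' zh'); apply: (bochner_inner_eq0 ip_norm Lz zz).
exact: H_op_L2O zh'.
Qed.

(** A vector orthogonal to Im H is automatically in the domain of H H*, where it
is mapped to 0. *)
Lemma positive_definite_orthogonal y :
  HHadj_positive_definite lambda r phi alpha T ip C momega -> L2n nu y ->
  (forall h, image_of H h -> L2n_inner nu h y = 0) -> L2n_zero momega y.
Proof.
move=> pos Ly y0; apply: contrapT => yN0.
have HHy : comp_graph H Hstar y 0.
  by exists 0; [exact/(H_adj_0P Ly)|exact: H_op_0].
have := pos y 0 HHy yN0; rewrite y0 ?ltxx//.
by exists 0; exact: H_op_0.
Qed.

Lemma orthogonal_approx_G_observable :
  (forall y, L2n nu y -> (forall h, image_of H h -> L2n_inner nu h y = 0) ->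
     L2n_zero momega y) ->
  approx_G_observable lambda r phi alpha T ip C momega.
Proof.
move=> orth; apply: L2n_closure_trivial_orthogonal.
- exact: image_H_op_L2n.
- by exists 0; exact: H_op_0.
- by move=> c h h' [z zh] [z' zh']; exists (c *: z + z'); exact: H_op_lin.
- by move=> y Ly /(orth y Ly)[_ y0]; exact: L2n_ae_inner0.
Qed.

End observability_theory.

Theorem proposition4 (R : realType) (n : nat) (n_gt0 : (0 < n)%N)
    (Omega : set 'rV[R]_n) (oOmega : open Omega)
    (bOmega : bounded_set Omega) (cOmega : connected Omega)
    (lOmega : lipschitz_boundary Omega)
    (T : R) (T_gt0 : 0 < T)
    (alpha : R) (alpha_gt0 : 0 < alpha) (alpha_le1 : alpha <= 1)
    (a : 'I_n -> 'I_n -> 'rV[R]_n -> R)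
    (a_C1 : forall k l, C1_closure Omega (a k l))
    (a_sym : forall k l x, closure Omega x -> a k l x = a l k x)
    (mu : R) (mu_gt0 : 0 < mu)
    (a_elliptic : forall x (xi : 'rV[R]_n), Omega x ->
       mu * enorm xi ^+ 2 <=
       \sum_k \sum_l a k l x * xi ord0 k * xi ord0 l)
    (lambda : nat -> R) (r : nat -> nat) (phi : nat -> nat -> 'rV[R]_n -> R)
    (spectral : spectral_basis oOmega a lambda r phi)
    (O : completeNormedModType R) (ip : {dot O for idfun})
    (ip_norm : forall x : O, ip x x = `|x| ^+ 2)
    (C : observation_operator (mu_open oOmega) O)
    (C_admissible : admissible lambda r phi alpha T C a)
    (omega : set 'rV[R]_n) (momega : measurable omega)
    (omega_Omega : omega `<=` Omega) :
  [<-> approx_G_observable lambda r phi alpha T ip C momega;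
       H_adj_kernel lambda r phi alpha T ip C momega = L2n_zero momega;
       HHadj_positive_definite lambda r phi alpha T ip C momega;
       forall y : 'I_n -> 'rV[R]_n -> R, L2n (mu_sub momega) y ->
         (forall z v g, L2O T z -> K_adj lambda r phi alpha T ip C z v ->
            grad oOmega v g ->
            L2n_inner (mu_open oOmega) (chi_adj omega y) g = 0) ->
         L2n_zero momega y].
Proof.
tfae.
- exact: approx_G_observable_kernel.
- exact: kernel_positive_definite.
- move=> pos y Ly /(orthogonal_image_HP _ _ _ _ _ _ _ omega_Omega Ly).
  exact: positive_definite_orthogonal.
- move=> cond; apply: orthogonal_approx_G_observable => // y Ly y0.
  by apply: cond => //;
    exact/(orthogonal_image_HP _ _ _ _ _ _ _ omega_Omega Ly).
Qed.
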